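(* Let $G$ be a complete bipartite graph with a horn, $G: X-U-v-Y$. Then there exists a po-semiring $A$ such that $\Gamma(A)\cong G$.
   Context: A commutative semiring is a set $A$ with two distinct elements $0,1$ and two operations $+,\cdot$ such that $(A,+,0)$ and $(A,\cdot,1)$ are commutative monoids, multiplication distributes over addition, and $0\cdot a=0$ for all $a\in A$. A po-semiring is a commutative semiring $(A,+,\cdot,0,1)$ together with a partial order $\le$ on $A$ such that: $x\le y$ implies $x+z\le y+z$; $0\le x$ and $y\le z$ imply $xy\le xz$ (for all $x,y,z\in A$); and $0$ is the least element and $1$ is the largest element of $A$. The zero-divisor graph $\Gamma(A)$ of a po-semiring $A$ is the simple graph whose vertices are the nonzero multiplicative zero-divisors of $A$ (nonzero $x$ with $xy=0$ for some nonzero $y\in A$), distinct vertices $x,y$ being adjacent iff $xy=0$. A complete bipartite graph with a horn, denoted $X-U-v-Y$, is a simple graph whose vertex set is a disjoint union $X\cup U\cup\{v\}\cup Y$ with $X,U,Y$ nonempty (of arbitrary, finite or infinite, cardinality), whose edges are exactly: all pairs between $X$ and $U$, all pairs between $U$ and $\{v\}$, and all pairs between $\{v\}$ and $Y$. *)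

(* Defs.v *)
From mathcomp Require Import all_boot all_algebra.
From mathcomp Require Import boolp classical_sets.
Set Implicit Arguments.
Unset Strict Implicit.
Unset Printing Implicit Defensive.
Import GRing.Theory.

Local Open Scope classical_set_scope.
Local Open Scope ring_scope.

(* [ple] is a plain relation rather than an order instance because MathComp
   already reserves the join of [Order.POrder] with additive structures for
   ordered Z-modules. *)
Record poSemiRing := PoSemiRing {
  po_sort :> comNzSemiRingType;
  ple : rel po_sort;
  ple_refl : reflexive ple;
  ple_anti : antisymmetric ple;
  ple_trans : transitive ple;
  ple_add2r : forall x y z, ple x y -> ple (x + z) (y + z);
  ple_mul2l : forall x y z, ple 0 x -> ple y z -> ple (x * y) (x * z);
  ple0x : forall x, ple 0 x;
  plex1 : forall x, ple x 1
}.

Record simple_graph := SimpleGraph {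
  vertex :> Type;
  adj : vertex -> vertex -> Prop;
  adj_sym : forall x y, adj x y -> adj y x;
  adj_irrefl : forall x, ~ adj x x
}.

Definition graph_iso (G H : simple_graph) : Prop :=
  exists f : G -> H,
    bijective f /\ forall x y : G, adj x y <-> adj (f x) (f y).

Definition nz_zero_divisors (A : poSemiRing) : set A :=
  [set x | x != 0 /\ exists y : A, y != 0 /\ x * y = 0].
Arguments nz_zero_divisors A : clear implicits.

Section ZeroDivisorGraph.
Variable A : poSemiRing.

Definition zd_adj (x y : nz_zero_divisors A) : Prop :=
  x <> y /\ val x * val y = 0.

Lemma zd_adj_sym x y : zd_adj x y -> zd_adj y x.
Proof. by case=> xy xy0; split; [exact: nesym | rewrite mulrC]. Qed.

Lemma zd_adj_irrefl x : ~ zd_adj x x.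
Proof. by case. Qed.

Definition zero_divisor_graph : simple_graph :=
  SimpleGraph zd_adj_sym zd_adj_irrefl.

End ZeroDivisorGraph.

Definition between (T : Type) (S1 S2 : set T) (x y : T) : Prop :=
  (S1 x /\ S2 y) \/ (S2 x /\ S1 y).

(* G is the graph X - U - v - Y. *)
Record bipartite_with_horn (G : simple_graph)
    (X U : set G) (v : G) (Y : set G) : Prop := BipartiteWithHorn {
  horn_X_neq0 : X !=set0;
  horn_U_neq0 : U !=set0;
  horn_Y_neq0 : Y !=set0;
  horn_cover : X `|` U `|` [set v] `|` Y = setT;
  horn_XU : X `&` U = set0;
  horn_XY : X `&` Y = set0;
  horn_UY : U `&` Y = set0;
  horn_vX : ~ X v;
  horn_vU : ~ U v;
  horn_vY : ~ Y v;
  horn_adj : forall x y : G, adj x y <->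
    [\/ between X U x y, between U [set v] x y | between [set v] Y x y]
}.

(* Main.v *)
Require Import Defs.
From HB Require Import structures.
From mathcomp Require Import all_boot all_algebra.
From mathcomp Require Import boolp classical_sets wochoice.
Set Implicit Arguments.
Unset Strict Implicit.
Unset Printing Implicit Defensive.
Import GRing.Theory.
Local Open Scope ring_scope.

(** Suppose first that X, U and Y are singletons. The required semiring is then
the product of two chains with join as addition: a three-element chain
0 < n < 1, where n * n = 0, and the two-element chain 0 < 1.
Besides 0 and 1 it has four elements, which are exactly its nonzero zero
divisors:
  X = (1, 0),   U = (0, 1),   v = (n, 0),   Y = (n, 1),
and its zero products of distinct nonzero elements are X U, U v and v Y. Its
elements are called shapes ([shape]).

For arbitrary X, U, Y, each of these three shapes is replaced by a fibre of the
prescribed size. Well-order the vertices, so that every fibre is a chain with a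
least element. Ordering the resulting set lexicographically (first by shape,
then inside the fibre) gives a semilattice, whose join is the addition. The
product of two elements is the least element over the product of their shapes,
so it vanishes exactly when the product of the shapes does
([blow_mul_eq0]), and any two vertices multiply as their shapes do. This product
has no identity in general: it collapses each fibre to its bottom. So a new
identity is added on top of everything; the old top of the shapes remains as a
non-zero-divisor, which is still the sum of elements of X and U.
Distributivity against the new identity is the law a + a b = a, and it holds
because a b lies below a lexicographically: either its shape is smaller, or it
is the bottom of the fibre of a ([lexsup_absorb]).

In all these semirings 1 + x = 1, and this identity alone makes the order
x <= y <-> x + y = y satisfy the po-semiring axioms ([natural_poSemiRing]).
Hence only the semiring axioms need to be checked for the blow-up. *)

(** * Semirings in which 1 absorbs addition *)

Section NaturalOrder.
Variable A : comNzSemiRingType.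
Hypothesis add1x : forall x : A, 1 + x = 1.
Implicit Types x y z : A.

Definition natle x y := x + y == y.

(** Distributivity turns 1 + y = 1 into absorption for every x; idempotence of
addition is the case y = 1. *)
Lemma addxMr x y : x + x * y = x.
Proof. by rewrite -[X in X + _]mulr1 -mulrDr add1x mulr1. Qed.

Lemma addxx x : x + x = x.
Proof. by rewrite -[X in _ + X]mulr1 addxMr. Qed.

Lemma natle_refl : reflexive natle.
Proof. by move=> x; rewrite /natle addxx. Qed.

Lemma natle_anti : antisymmetric natle.
Proof. by move=> x y /andP[/eqP + /eqP]; rewrite addrC => -> ->. Qed.

Lemma natle_trans : transitive natle.
Proof.
by move=> y x z /eqP xy /eqP yz; rewrite /natle -yz addrA xy.
Qed.

Lemma natle0x x : natle 0 x.
Proof. by rewrite /natle add0r. Qed.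

Lemma natle_addl x y : natle x (x + y).
Proof. by rewrite /natle addrA addxx. Qed.

Lemma natle_addr x y : natle y (x + y).
Proof. by rewrite addrC natle_addl. Qed.

Lemma natle_addLR x y z : natle (x + y) z = natle x z && natle y z.
Proof.
apply/idP/andP => [xyz|[/eqP xz /eqP yz]]; last by rewrite /natle -addrA yz xz.
by split; apply: natle_trans xyz; [exact: natle_addl|exact: natle_addr].
Qed.

Lemma natle_add2r x y z : natle x y -> natle (x + z) (y + z).
Proof.
by move=> xy; rewrite natle_addLR (natle_trans xy) ?natle_addl ?natle_addr.
Qed.

Lemma natle_mul2l x y z : natle 0 x -> natle y z -> natle (x * y) (x * z).
Proof. by move=> _ /eqP yz; rewrite /natle -mulrDr yz. Qed.

Lemma natlex1 x : natle x 1.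
Proof. by rewrite /natle addrC add1x. Qed.

Definition natural_poSemiRing : poSemiRing :=
  PoSemiRing natle_refl natle_anti natle_trans natle_add2r natle_mul2l
    natle0x natlex1.

End NaturalOrder.

(** * Blowing up the elements of a semiring *)

(** The fibre of [pi] over p replaces the element p of S; [bot p] is its least
element for the total order [R]. *)
Section Blowup.
Variables (S : comNzSemiRingType) (T : choiceType).
Variables (pi : T -> S) (bot : S -> T) (R : rel T).
Hypothesis add1p : forall p : S, 1 + p = 1.
Hypothesis pi_bot : cancel bot pi.
Hypotheses (Ranti : antisymmetric R) (Rtrans : transitive R) (Rtotal : total R).
Hypothesis bot_min : forall a, R (bot (pi a)) a.
Implicit Types (a b c : T) (p q : S).

Definition lexle a b :=
  natle (pi a) (pi b) && ((pi a == pi b) ==> R a b).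

Lemma lexle_refl : reflexive lexle.
Proof. by move=> a; rewrite /lexle natle_refl// eqxx -[R a a]orbb Rtotal. Qed.

Lemma lexle_anti : antisymmetric lexle.
Proof.
move=> a b /andP[/andP[ab Rab] /andP[ba Rba]].
have e : pi a = pi b by apply: natle_anti; rewrite ab.
by apply: Ranti; move: Rab Rba; rewrite e eqxx => /= -> ->.
Qed.

Lemma lexle_trans : transitive lexle.
Proof.
move=> b a c /andP[ab Rab] /andP[bc Rbc]; apply/andP; split.
  exact: natle_trans bc.
apply/implyP => /eqP ac.
have e : pi a = pi b by apply: natle_anti; rewrite ab ac.
by apply: (@Rtrans b); [move: Rab|move: Rbc; rewrite -ac]; rewrite e eqxx.
Qed.

Lemma lexle_botl p a : lexle (bot p) a = natle p (pi a).
Proof.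
rewrite /lexle pi_bot; case: (eqVneq p) => [->|]; last by rewrite andbT.
by rewrite bot_min implybT andbT.
Qed.

(** Together with [lexsup_le], this yields every identity between joins. *)
Lemma lexle_ext a b : (forall c, lexle a c = lexle b c) -> a = b.
Proof.
move=> ab; apply: lexle_anti.
by rewrite ab lexle_refl -ab lexle_refl.
Qed.

(** If a and b are incomparable, so are their shapes, because each fibre is a
chain; their common upper bounds then all lie over or above pi a + pi b. *)
Definition lexsup a b :=
  if lexle a b then b else if lexle b a then a else bot (pi a + pi b).

Lemma lexle_incomp a b :
  ~~ lexle a b -> ~~ lexle b a -> ~~ natle (pi a) (pi b).
Proof.
move=> nab nba; apply/negP => ab; move: nab nba.
rewrite /lexle ab /= negb_imply => /andP[/eqP <- nRab].
rewrite eqxx natle_refl//=.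
by case/orP: (Rtotal a b) nRab => ->.
Qed.

(** The universal property of the join. In the incomparable case pi a + pi b
differs from both pi a and pi b, so the order inside the fibres is not involved
on the side of a and b, while any element of the fibre over pi a + pi b lies
above its bottom. *)
Lemma lexsup_le a b c : lexle (lexsup a b) c = lexle a c && lexle b c.
Proof.
rewrite /lexsup; case: ifPn => ab.
  by apply/idP/andP => [bc|[]//]; split=> //; apply: lexle_trans bc.
case: ifPn => ba.
  by apply/idP/andP => [ac|[]//]; split=> //; apply: lexle_trans ac.
rewrite lexle_botl natle_addLR //.
apply/andP/andP => -[ac bc]; last first.
  by case/andP: ac; case/andP: bc.
split; rewrite /lexle ?ac ?bc /=; apply/implyP => /eqP e.
  by move: (lexle_incomp ba ab); rewrite e bc.
by move: (lexle_incomp ab ba); rewrite e ac.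
Qed.

Lemma lexsupC : commutative lexsup.
Proof. by move=> a b; apply: lexle_ext => c; rewrite !lexsup_le andbC. Qed.

Lemma lexsupA : associative lexsup.
Proof. by move=> a b c; apply: lexle_ext => d; rewrite !lexsup_le andbA. Qed.

Lemma lexsup_idPr a b : lexle a b -> lexsup a b = b.
Proof. by rewrite /lexsup => ->. Qed.

Lemma pi_lexsup a b : pi (lexsup a b) = pi a + pi b.
Proof.
rewrite /lexsup; case: ifPn => [/andP[/eqP-> //]|_].
by case: ifPn => [/andP[/eqP + _]|]; rewrite 1?addrC ?pi_bot.
Qed.

Lemma lexsup_bot p q : lexsup (bot p) (bot q) = bot (p + q).
Proof.
apply: lexle_ext => c.
by rewrite lexsup_le !lexle_botl natle_addLR.
Qed.

(** [None] is the new top element, which serves as the identity. *)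
Definition blow_add (x y : option T) :=
  if x is Some a then if y is Some b then Some (lexsup a b) else None else None.

Definition blow_mul (x y : option T) :=
  match x, y with
  | None, z | z, None => z
  | Some a, Some b => Some (bot (pi a * pi b))
  end.

Lemma blow_addA : associative blow_add.
Proof. by move=> [a|] [b|] [c|] //=; rewrite lexsupA. Qed.

Lemma blow_addC : commutative blow_add.
Proof. by move=> [a|] [b|] //=; rewrite lexsupC. Qed.

Lemma blow_add0 : left_id (Some (bot 0)) blow_add.
Proof.
by move=> [a|] //=; rewrite lexsup_idPr// lexle_botl natle0x.
Qed.

Lemma blow_mulA : associative blow_mul.
Proof. by move=> [a|] [b|] [c|] //=; rewrite !pi_bot mulrA. Qed.

Lemma blow_mulC : commutative blow_mul.
Proof. by move=> [a|] [b|] //=; rewrite mulrC. Qed.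

Lemma blow_mul1 : left_id None blow_mul.
Proof. by case. Qed.

(** In S, pi a * p lies below pi a; when the two coincide, the product is the
bottom of the fibre containing a. *)
Lemma lexsup_absorb a p : lexsup (bot (pi a * p)) a = a.
Proof.
by rewrite lexsup_idPr// lexle_botl /natle addrC addxMr.
Qed.

(** Between elements of T, both sides are bottoms of fibres, and [bot] preserves
joins. When one summand is the new identity, the equation is an instance of
absorption. *)
Lemma blow_mulDl : left_distributive blow_mul blow_add.
Proof.
move=> [a|] [b|] [c|] //=; rewrite ?lexsup_bot ?pi_lexsup ?mulrDl//.
- by rewrite mulrC lexsup_absorb.
- by rewrite lexsupC mulrC lexsup_absorb.
- by rewrite lexsup_idPr ?lexle_refl.
Qed.

Lemma blow_mul0 : left_zero (Some (bot 0)) blow_mul.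
Proof. by move=> [a|] //=; rewrite pi_bot mul0r. Qed.

Definition blow_nmod : nmodType :=
  HB.pack (option T) (GRing.isNmodule.Build (option T) blow_addA blow_addC blow_add0).

Definition blow_semiring : comNzSemiRingType :=
  HB.pack (option T) blow_nmod
   (GRing.Nmodule_isComNzSemiRing.Build blow_nmod blow_mulA blow_mulC blow_mul1
      blow_mulDl blow_mul0 isT).

Lemma blow_add1x (x : blow_semiring) : 1 + x = 1.
Proof. by []. Qed.

Definition blow : poSemiRing := natural_poSemiRing blow_add1x.

Lemma blow_mul_eq0 a b :
  (Some a : blow) * (Some b : blow) = 0 <-> pi a * pi b = 0.
Proof.
split=> [[]|ab]; first by move/(can_inj pi_bot).
by congr Some; rewrite ab.
Qed.
End Blowup.

(** * The semiring of shapes *)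

(** The product of the chains 0 < n < 1 (with n * n = 0) and 0 < 1, its elements
named after the part of the graph that they stand for: SX = (1, 0),
SU = (0, 1), Sv = (n, 0), SY = (n, 1). *)
Inductive shape := S0 | SX | SU | Sv | SY | S1.

HB.instance Definition _ := gen_eqMixin shape.
HB.instance Definition _ := gen_choiceMixin shape.

Definition shape_add p q :=
  match p, q with
  | S0, r | r, S0 => r
  | Sv, Sv => Sv
  | SU, SU => SU
  | SX, (SX | Sv) | Sv, SX => SX
  | SY, (SY | SU | Sv) | (SU | Sv), SY | SU, Sv | Sv, SU => SY
  | _, _ => S1
  end.

Definition shape_mul p q :=
  match p, q with
  | S1, r | r, S1 => r
  | SX, SX => SX
  | SX, (Sv | SY) | (Sv | SY), SX => Sv
  | (SU | SY), (SU | SY) => SU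
  | _, _ => S0
  end.

Lemma shape_addA : associative shape_add.
Proof. by do 3!case. Qed.

Lemma shape_addC : commutative shape_add.
Proof. by do 2!case. Qed.

Lemma shape_add0 : left_id S0 shape_add.
Proof. by case. Qed.

HB.instance Definition _ :=
  GRing.isNmodule.Build shape shape_addA shape_addC shape_add0.

Lemma shape_mulA : associative shape_mul.
Proof. by do 3!case. Qed.

Lemma shape_mulC : commutative shape_mul.
Proof. by do 2!case. Qed.

Lemma shape_mul1 : left_id S1 shape_mul.
Proof. by case. Qed.

Lemma shape_mulDl : left_distributive shape_mul shape_add.
Proof. by do 3!case. Qed.

Lemma shape_mul0 : left_zero S0 shape_mul.
Proof. by case. Qed.

Lemma shape_1neq0 : S1 != S0.
Proof. exact/eqP. Qed.

HB.instance Definition _ :=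
  GRing.Nmodule_isComNzSemiRing.Build shape shape_mulA shape_mulC shape_mul1
    shape_mulDl shape_mul0 shape_1neq0.

Lemma shape_add1p (p : shape) : 1 + p = 1.
Proof. by case: p. Qed.

(** * Well-orders *)

Section WellOrder.
Variables (T : eqType) (R : rel T).
Hypothesis Rwo : well_order R.

Let Rchain : wo_chain R predT.
Proof. by apply: withinW. Qed.

Lemma well_order_total : total R.
Proof. by move=> x y; apply: (wo_chainW Rchain). Qed.

Lemma well_order_anti : antisymmetric R.
Proof. by move=> x y; apply: (wo_chain_antisymmetric Rchain). Qed.

Lemma well_order_trans : transitive R.
Proof.
move=> y x z Rxy Ryz.
(* Whichever of x, y, z is the least, R x z follows by antisymmetry. *)
have [|m [[+ /allP]]] := @Rwo [mem [:: x; y; z]].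
  by exists x; apply: mem_head.
rewrite !inE /= andbT => m_xyz /and3P[mx my mz] _.
case/or3P: m_xyz => /eqP e; subst m => //.
- by rewrite (@well_order_anti x y) ?Rxy.
- by rewrite -(@well_order_anti y z) ?Ryz.
Qed.

(** Provides the fibre bottoms needed for the blow-up. *)
Lemma well_order_section (S : eqType) (pi : T -> S) :
  (forall p, exists a, pi a = p) ->
  exists2 bot, cancel bot pi & forall a, R (bot (pi a)) a.
Proof.
move=> pi_onto.
have /choice[bot botP] p : exists m, minimum_of R [pred a | pi a == p] m.
  have [|m [m_min _]] := @Rwo [pred a | pi a == p]; last by exists m.
  by have [a /eqP ap] := pi_onto p; exists a.
exists bot => [p|a]; first by have [/eqP] := botP p.
by have [_] := botP (pi a); apply; rewrite inE.
Qed.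
End WellOrder.

(** * Shapes of the vertices of a complete bipartite graph with a horn *)

Section Horn.
Variables (G : simple_graph) (X U : set G) (v : G) (Y : set G).
Hypothesis hG : bipartite_with_horn X U v Y.
Implicit Types g h : G.

Definition shape_of g : shape :=
  if `[< X g >] then SX else if `[< U g >] then SU
  else if `[< g = v >] then Sv else SY.

Lemma horn_case g : [\/ X g, U g, g = v | Y g].
Proof.
have : (X `|` U `|` [set v] `|` Y)%classic g by rewrite (horn_cover hG).
by case=> [[[]|]|] ?; [apply: Or41|apply: Or42|apply: Or43|apply: Or44].
Qed.

Lemma shape_ofX g : X g -> shape_of g = SX.
Proof. by move=> Xg; rewrite /shape_of asboolT. Qed.

Lemma shape_ofU g : U g -> shape_of g = SU.
Proof.
move=> Ug; rewrite /shape_of asboolF ?asboolT// => Xg.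
by have : (X `&` U)%classic g by []; rewrite (horn_XU hG).
Qed.

Lemma shape_ofv : shape_of v = Sv.
Proof.
by rewrite /shape_of asboolF ?(asboolF (horn_vU hG)) ?asboolT//; apply: horn_vX hG.
Qed.

Lemma shape_ofY g : Y g -> shape_of g = SY.
Proof.
move=> Yg; rewrite /shape_of !asboolF// => [gv|Ug|Xg].
- by move: Yg; rewrite gv; apply: horn_vY hG.
- by have : (U `&` Y)%classic g by []; rewrite (horn_UY hG).
- by have : (X `&` Y)%classic g by []; rewrite (horn_XY hG).
Qed.

(** Distinctness excludes the pair v, v, for which Sv * Sv = 0. On all other
pairs the product of the shapes alone decides adjacency. *)
Lemma adj_shape g h : adj g h <-> g <> h /\ shape_of g * shape_of h = 0.
Proof.
split=> [gh|[gh]].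
  split=> [e|]; first by move: gh; rewrite e; apply: adj_irrefl.
  case/(horn_adj hG): gh => -[] [].
  - by move=> /shape_ofX-> /shape_ofU->.
  - by move=> /shape_ofU-> /shape_ofX->.
  - by move=> /shape_ofU-> ->; rewrite shape_ofv.
  - by move=> -> /shape_ofU->; rewrite shape_ofv.
  - by move=> -> /shape_ofY->; rewrite shape_ofv.
  - by move=> /shape_ofY-> ->; rewrite shape_ofv.
rewrite (horn_adj hG) /between /=.
case: (horn_case g) => [/[dup]/shape_ofX-> Hg|/[dup]/shape_ofU-> Hg|Hg
    |/[dup]/shape_ofY-> Hg]; rewrite ?Hg ?shape_ofv;
  case: (horn_case h) => [/[dup]/shape_ofX-> Hh|/[dup]/shape_ofU-> Hh|Hh
    |/[dup]/shape_ofY-> Hh]; rewrite ?Hh ?shape_ofv => // _.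
all: try by [apply: Or31; intuition|apply: Or32; intuition|apply: Or33; intuition].
by case: gh; rewrite Hg Hh.
Qed.

(** Ensures that every vertex becomes a zero divisor. *)
Lemma adj_exists g : exists h, adj g h.
Proof.
have [x Xx] := horn_X_neq0 hG; have [u Uu] := horn_U_neq0 hG.
case: (horn_case g) => [Xg|Ug|->|Yg]; [exists u|exists x|exists u|exists v];
  apply/(horn_adj hG).
- by apply: Or31; left.
- by apply: Or31; right.
- by apply: Or32; right.
- by apply: Or33; right.
Qed.

(** The points over all shapes: [None] lies over 0 and [Some None] over 1, each
alone in its fibre, since these shapes must not produce vertices. *)
Definition points : choiceType := option (option {classic G}).

Definition shape_map (t : points) : shape :=
  match t with
  | None => 0
  | Some None => 1
  | Some (Some g) => shape_of g
  end.

Lemma shape_of_neq0 g : shape_of g <> 0.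
Proof.
by case: (horn_case g) => [/shape_ofX->|/shape_ofU->|->|/shape_ofY->] //;
  rewrite shape_ofv.
Qed.

Lemma shape_map_eq0 t : shape_map t = 0 -> t = None.
Proof. by case: t => [[g /shape_of_neq0|]|]. Qed.

Lemma shape_map_onto p : exists t, shape_map t = p.
Proof.
have [x Xx] := horn_X_neq0 hG; have [u Uu] := horn_U_neq0 hG.
have [y Yy] := horn_Y_neq0 hG.
case: p; [by exists None| | | | |by exists (Some None)].
- by exists (Some (Some x)); apply: shape_ofX.
- by exists (Some (Some u)); apply: shape_ofU.
- by exists (Some (Some v)); apply: shape_ofv.
- by exists (Some (Some y)); apply: shape_ofY.
Qed.
End Horn.

Theorem lemma2p2 (G : simple_graph) (X U : set G) (v : G) (Y : set G)
    (hG : bipartite_with_horn X U v Y) :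
  exists A : poSemiRing, graph_iso (zero_divisor_graph A) G.
Proof.
pose pi := shape_map X U v.
have [R Rwo] := well_ordering_principle (points G).
have [bot pi_bot bot_min] := well_order_section Rwo (shape_map_onto hG).
pose A : poSemiRing := blow shape_add1p pi_bot (well_order_anti Rwo)
  (well_order_trans Rwo) (well_order_total Rwo) bot_min.
have mul0 a b : (Some a : A) * (Some b : A) = 0 <-> pi a * pi b = 0.
  exact: blow_mul_eq0.
have zeroE : (0 : A) = Some None.
  by congr Some; apply: (shape_map_eq0 hG); apply: pi_bot.
pose vtx (g : G) : A := Some (Some (Some g)).
have vtx_neq0 g : vtx g != 0 by apply/eqP; rewrite zeroE.
have mul_vtx g h :
    vtx g * vtx h = 0 <-> shape_of X U v g * shape_of X U v h = 0.
  exact: mul0.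
have vtx_zd g : nz_zero_divisors A (vtx g).
  split=> //; have [h /(adj_shape hG)[_ gh]] := adj_exists hG g.
  by exists (vtx h); split=> //; apply/mul_vtx.
have zd_vtx (x : A) : nz_zero_divisors A x -> exists g, x = vtx g.
  (* The candidates other than vertices: the top shape, which multiplies
     without changing the shape, the zero element, and the new identity. *)
  case=> x0 [y [y0 xy0]]; case: x x0 xy0 => [[[g|]|]|] x0 xy0.
  - by exists g.
  - case: y y0 xy0 => [b|] y0 xy0; last by case/eqP: x0; exact: xy0.
    move/mul0: xy0; rewrite mul1r => /(shape_map_eq0 hG) b0.
    by move: y0; rewrite zeroE b0 eqxx.
  - by move: x0; rewrite zeroE eqxx.
  - by move: y0; rewrite -xy0 eqxx.
pose back (g : G) : zero_divisor_graph A := SigSub (mem_set (vtx_zd g)).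
(* v is a dummy value: zero divisors are never of the other forms. *)
pose f (x : zero_divisor_graph A) : G :=
  if val x is Some (Some (Some g)) then g else v.
have valE x : val x = vtx (f x).
  by rewrite /f; have [g ->] := zd_vtx _ (set_valP x).
exists A, f; split.
  by exists back => [x|g] //; apply: val_inj; rewrite /= -valE.
move=> x y; rewrite (adj_shape hG) /= /zd_adj !valE mul_vtx.
split=> -[xy ?]; split=> // e; apply: xy; last by rewrite e.
by apply: val_inj; rewrite !valE e.
Qed.
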